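(* Let $G$ be a connected finite simple graph with $|E_G|\ge 2$. If there is a set $E_c$ of connecting edges of $G$ such that $E_c$ separates $G$ (i.e., the graph $(V_G,E_G\setminus E_c)$ is disconnected) and the subgraph of $G$ induced by $E_c$ contains no path of length four, then $G$ has a NAC-coloring.
   Context: An edge of $G$ is a connecting edge if it belongs to no triangle (subgraph isomorphic to $C_3$) of $G$. The subgraph induced by an edge set $E_c$ consists of the edges in $E_c$ together with their endpoints; the length of a path is its number of edges. A coloring $\delta\colon E_G\to\{\text{blue},\text{red}\}$ is a NAC-coloring if it is surjective and $G$ contains no cycle with exactly one blue edge and no cycle with exactly one red edge. *)

(* Defs.v *)
From mathcomp Require Import all_boot.
Set Implicit Arguments.
Unset Strict Implicit.
Unset Printing Implicit Defensive.

Record sgraph := SGraph {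
  vertex :> finType;
  edges : {set {set vertex}};
  edges_card2 : forall A : {set vertex}, A \in edges -> #|A| = 2 }.

Definition edge (G : sgraph) : Type := {A : {set G} | A \in edges G}.

Definition adj (G : sgraph) : rel G := [rel x y | [set x; y] \in edges G].

Definition connected (G : sgraph) : Prop := forall x y : G, connect (@adj G) x y.

(* A path is recorded by its sequence of pairwise distinct vertices x :: p,
   so size p is its number of edges. *)
Definition contains_path_of_length (G : sgraph) (k : nat) : Prop :=
  exists (x : G) (p : seq G),
    [/\ path (@adj G) x p, uniq (x :: p) & size p = k].

(* ucycleb alone would also accept the empty sequence and x -- y -- x. *)
Definition is_cycle (G : sgraph) (c : seq G) : bool :=
  (2 < size c) && ucycleb (@adj G) c.

Definition cycle_edges (G : sgraph) (c : seq G) : {set {set G}} :=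
  [set [set x; next c x] | x in c].

Definition connecting_edge (G : sgraph) (A : {set G}) : Prop :=
  A \in edges G /\
  forall c : seq G, is_cycle c -> size c = 3 -> A \notin cycle_edges c.

Lemma del_edges_card2 (G : sgraph) (F : {set {set G}}) (A : {set G}) :
  A \in edges G :\: F -> #|A| = 2.
Proof. by case/setDP => /edges_card2. Qed.

Definition del_edges (G : sgraph) (F : {set {set G}}) : sgraph :=
  SGraph (@del_edges_card2 G F).

(* The vertices are the endpoints of the edges in F; members of F that are not
   edges of G contribute nothing. *)
Definition endpoint (G : sgraph) (F : {set {set G}}) : finType :=
  {x : G | x \in cover (edges G :&: F)}.

Definition induced_edges (G : sgraph) (F : {set {set G}}) :
    {set {set endpoint F}} :=
  [set A : {set endpoint F} | [set val x | x in A] \in edges G :&: F].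

Lemma induced_edges_card2 (G : sgraph) (F : {set {set G}})
    (A : {set endpoint F}) : A \in induced_edges F -> #|A| = 2.
Proof.
rewrite inE => /setIP[/edges_card2 <- _].
by rewrite card_imset //; apply: val_inj.
Qed.

Definition edge_induced_subgraph (G : sgraph) (F : {set {set G}}) : sgraph :=
  SGraph (@induced_edges_card2 G F).

Variant color := blue | red.

Definition has_exactly_one (G : sgraph) (delta : edge G -> color)
    (k : color) (c : seq G) : Prop :=
  exists! a : edge G, val a \in cycle_edges c /\ delta a = k.

Definition NAC_coloring (G : sgraph) (delta : edge G -> color) : Prop :=
  (forall k : color, exists a : edge G, delta a = k) /\
  (forall c : seq G, is_cycle c ->
     ~ has_exactly_one delta blue c /\ ~ has_exactly_one delta red c).

(* Main.v *)
(* Let S be the vertex set of a component of G - Ec and colour red the edges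
   crossing S; all of them lie in Ec.  A cycle crosses S an even number of
   times, so it has no single red edge.  If it had a single blue edge, its
   other edges would form a red path: of length 2, it gives a triangle through
   a connecting edge; of length 3, the blue edge would cross S as well; of
   length at least 4, it contradicts the hypothesis on Ec.  If no edge is blue,
   then G is triangle-free, and one colours red instead the edges at a vertex v
   lying on some edge but not on all of them: a cycle has 0 or 2 edges at v and
   at least two other edges. *)
Require Import Defs.
From mathcomp Require Import all_boot.
Set Implicit Arguments.
Unset Strict Implicit.
Unset Printing Implicit Defensive.

(** * Edges of a cycle and its successor map *)

Section Cycles.
Variable G : sgraph.
Implicit Types (x y : G) (c p : seq G) (A : {set G}) (R : {set {set G}}).

Lemma adjC x y : adj x y = adj y x.
Proof. by rewrite /adj /= setUC. Qed.

Lemma is_cycle_rot n c : is_cycle (rot n c) = is_cycle c.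
Proof. by rewrite /is_cycle /ucycleb size_rot rot_cycle rot_uniq. Qed.

Lemma is_cycle_uniq c : is_cycle c -> uniq c.
Proof. by case/andP=> _ /andP[]. Qed.

(** With [x] rotated to the front, its second successor is the third vertex, and a cycle has at
    least three, all distinct. *)
Lemma next_next_neq c x : is_cycle c -> x \in c -> next c (next c x) != x.
Proof.
move=> Cc xc; have [i s def_c] := rot_to xc.
have Uc := is_cycle_uniq Cc.
move: Cc; rewrite -!(next_rot i Uc) -(is_cycle_rot i) def_c.
case: s {def_c} => [|y [|z s]] //= /is_cycle_uniq /=.
rewrite eqxx; rewrite !inE !negb_or => /andP[/and3P[xy xz _] _].
by rewrite (eq_sym y) (negbTE xy) eqxx eq_sym.
Qed.

(** Distinct vertices with the same outgoing edge would be each other's successors, against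
    [next_next_neq]. *)
Lemma next_edge_inj c : is_cycle c ->
  {in c &, injective (fun x => [set x; next c x])}.
Proof.
move=> Cc x y xc yc /= eq_xy; apply/eqP; apply: contraT => neq_xy.
have: x \in [set y; next c y] by rewrite -eq_xy set21.
have: y \in [set x; next c x] by rewrite eq_xy set21.
rewrite !inE (negbTE neq_xy) eq_sym (negbTE neq_xy) /= => /eqP def_y /eqP def_x.
by have := next_next_neq Cc xc; rewrite -def_y -def_x eqxx.
Qed.

Lemma next_in_edges c x : is_cycle c -> x \in c -> [set x; next c x] \in edges G.
Proof. by case/andP=> _ /andP[cyc_c _]; apply: (next_cycle cyc_c). Qed.

Lemma path_next c x p (e : rel G) : uniq c -> c = x :: p ->
  (forall y, y \in c -> y != last x p -> e y (next c y)) -> path e x p.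
Proof.
move=> Uc def_c He; apply/(pathP x) => i lt_ip.
have Uxp : uniq (x :: p) by rewrite -def_c.
have iq : i < size (x :: p) by rewrite /= ltnW.
have := He (nth x (x :: p) i); rewrite def_c mem_nth // => /(_ isT).
rewrite next_nth mem_nth // index_uniq //; apply.
rewrite (last_nth x) nth_uniq //=.
by rewrite neq_ltn lt_ip.
Qed.

Lemma next_last x p : uniq (x :: p) -> next (x :: p) (last x p) = x.
Proof.
move=> U; rewrite next_nth mem_last.
by rewrite index_last // nth_default.
Qed.

(** Turns [exists!] over edges into a fact about sequences: rotate the cycle until its unique edge
    with [P] joins the last vertex to the first. *)
Lemma exactly_one_closing_path (P : pred {set G}) c :
    is_cycle c ->
    (exists! a : edge G, val a \in cycle_edges c /\ P (val a)) ->
  exists x p, [/\ is_cycle (x :: p),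
    path [rel u v | adj u v && ~~ P [set u; v]] x p & P [set last x p; x]].
Proof.
move=> Cc [a [[/imsetP[z zc def_a] Pa] uniq_a]].
(* This puts [z], the tail of the unique edge, first; one more rotation moves it to the end. *)
have [i s def_c] := rot_to zc.
have Uc := is_cycle_uniq Cc.
have [x [p def_xp]] : exists x p, x :: p = rcons s z.
  by case: s {def_c} => [|x p]; [exists z, [::] | exists x, (rcons p z)].
have last_p : last x p = z.
  by rewrite -[last x p]/(last x (x :: p)) def_xp last_rcons.
have def_r : rot 1 (rot i c) = x :: p by rewrite def_c rot1_cons def_xp.
have Cr : is_cycle (x :: p) by rewrite -def_r !is_cycle_rot.
have Ur := is_cycle_uniq Cr.
have next_r : next (x :: p) =1 next c.
  by move=> y; rewrite -def_r !next_rot ?rot_uniq.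
have mem_r : x :: p =i c by move=> y; rewrite -def_r !mem_rot.
exists x, p; split=> //; last first.
  by rewrite -{2}(next_last Ur) next_r last_p -def_a.
apply: (path_next Ur (erefl _)) => y yr; rewrite last_p => neq_yz.
have y_edge : [set y; next (x :: p) y] \in edges G by apply: next_in_edges.
apply/andP; split=> //; apply/negP=> Py.
have yc : y \in c by rewrite -mem_r.
(* Another edge with [P] would be [a] itself, and then [next_edge_inj] gives [y = z]. *)
have /(congr1 val) /= eq_a : a = exist _ [set y; next (x :: p) y] y_edge.
  by apply: uniq_a; split=> //; apply/imsetP; exists y; rewrite // -next_r.
case/eqP: neq_yz; apply: (next_edge_inj Cc) => //=.
by rewrite -next_r -eq_a def_a.
Qed.

(** * Colorings given by a set of red edges *)

Definition coloring_of R (a : edge G) : color :=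
  if val a \in R then red else blue.

(** Up to rotation, a cycle with a single edge of one color is a path of the other color closed by
    that edge. *)
Lemma coloring_of_NAC R :
    (exists2 A, A \in edges G & A \in R) ->
    (exists2 A, A \in edges G & A \notin R) ->
    (forall x p, is_cycle (x :: p) ->
       path [rel u v | adj u v && ([set u; v] \notin R)] x p ->
       [set last x p; x] \notin R) ->
    (forall x p, is_cycle (x :: p) ->
       path [rel u v | adj u v && ([set u; v] \in R)] x p ->
       [set last x p; x] \in R) ->
  NAC_coloring (coloring_of R).
Proof.
move=> [A EA RA] [B EB RB] one_red one_blue; split.
  case; first by exists (exist _ B EB); rewrite /coloring_of /= (negbTE RB).
  by exists (exist _ A EA); rewrite /coloring_of /= RA.
move=> c Cc; split=> -[a [[ac col_a] uniq_a]].
  have [|x [p [Cp pth]]] := @exactly_one_closing_path (fun A => A \notin R) c Cc.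
    exists a; split=> [|b [bc Rb]].
      by move: col_a; rewrite /coloring_of; case: ifP.
    by apply: uniq_a; rewrite /coloring_of (negbTE Rb).
  rewrite one_blue //; apply: sub_path pth => u v /=.
  by rewrite negbK.
have [|x [p [Cp pth]]] := @exactly_one_closing_path (mem R) c Cc.
  exists a; split=> [|b [bc Rb]].
      by move: col_a; rewrite /coloring_of /=; case: ifP.
  by apply: uniq_a; rewrite /coloring_of -[_ \in R]/(mem R (val b)) Rb.
by move=> /= Rlast; have := one_red x p Cp pth; rewrite Rlast.
Qed.

(** * Star colorings of triangle-free graphs *)

Lemma triangle_connecting_edge x y z :
  is_cycle [:: x; y; z] -> ~ connecting_edge [set x; y].
Proof.
move=> C [_ /(_ _ C erefl)/negP]; apply; apply/imsetP; exists x.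
  exact: mem_head.
by rewrite /= eqxx.
Qed.

Lemma star_NAC (v : G) :
    (forall A, A \in edges G -> connecting_edge A) ->
    (exists2 A, A \in edges G & v \in A) ->
    (exists2 A, A \in edges G & v \notin A) ->
  NAC_coloring (coloring_of [set A : {set G} | v \in A]).
Proof.
move=> conn [A EA vA] [B EB vB].
apply: coloring_of_NAC; [by exists A; rewrite ?inE | by exists B; rewrite ?inE | |].
  (* If [v] were an end of the closing edge, the last or first edge of the path would contain it
     too. *)
  move=> x p /andP[size_p _] pth; rewrite !inE negb_or; apply/andP; split.
    case/lastP: p size_p pth => // p z _.
    rewrite rcons_path last_rcons => /andP[_] /=.
    by rewrite !inE negb_or => /and3P[].
  by case: p size_p pth => //= y p _ /andP[]; rewrite !inE negb_or => /and3P[].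
move=> x [|a [|b [|d p]]] Cc //=.
  case/andP=> /andP[xa _] _.
  by case: (triangle_connecting_edge Cc); apply: conn.
(* The disjoint path edges [[set x; a]] and [[set b; d]] cannot both contain [v]. *)
have /and3P[/= xp ap _] := is_cycle_uniq Cc.
rewrite !inE => /and4P[/andP[_ vxa] _ /andP[_ vbd] _].
move: xp ap; rewrite !inE !negb_or.
by case/orP: vxa => /eqP <-; case/orP: vbd => /eqP <-; rewrite eqxx ?andbF.
Qed.

Lemma triangle_free_NAC : 2 <= #|edges G| ->
    (forall A, A \in edges G -> connecting_edge A) ->
  exists delta : edge G -> color, NAC_coloring delta.
Proof.
move=> /card_gt1P[A [B [EA EB neq_AB]]] conn.
(* Distinct edges have equal size, so they are not nested. *)
have /subsetPn[v vA vB] : ~~ (A \subset B).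
  apply: contra neq_AB => sAB; rewrite eqEcard sAB.
  by rewrite (edges_card2 EA) (edges_card2 EB).
by exists (coloring_of [set A : {set G} | v \in A]); apply: star_NAC; [|exists A|exists B].
Qed.

(** * Edge cuts, and paths in an edge-induced subgraph *)

Definition crossing (S : {set G}) : {set {set G}} :=
  [set A : {set G} | ~~ (A \subset S) && ~~ [disjoint A & S]].

Lemma crossing_set2 (S : {set G}) x y :
  ([set x; y] \in crossing S) = ((x \in S) != (y \in S)).
Proof.
rewrite inE disjoints_subset !subUset !sub1set !in_setC.
by case: (x \in S); case: (y \in S).
Qed.

(** The path lifts to the subtype of endpoints because each of its vertices lies on one of its
    edges, [x] on the first one. *)
Lemma contains_path_of_length_edge_induced (F : {set {set G}}) x p :
    0 < size p -> path [rel u v | adj u v && ([set u; v] \in F)] x p ->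
    uniq (x :: p) ->
  contains_path_of_length (edge_induced_subgraph F) (size p).
Proof.
move=> size_p pth Uxp; set U := cover (edges G :&: F).
have edge_in u v : adj u v -> [set u; v] \in F -> (u \in U) && (v \in U).
  move=> uv uvF; apply/andP; split; apply/bigcupP; exists [set u; v];
  by rewrite ?set21 ?set22 // inE uvF andbT.
have xU : x \in U.
  by case: p size_p pth {Uxp} => //= y p _ /andP[/andP[xy xyF] _];
     case/andP: (edge_in _ _ xy xyF).
have pU : all (mem U) p.
  elim: p x pth {size_p Uxp xU} => //= y p IHp x /andP[/andP[xy xyF] pth].
  by rewrite (IHp y) // andbT; case/andP: (edge_in _ _ xy xyF).
pose H := edge_induced_subgraph F.
have [q def_q] : exists q : seq H, map val q = p.
  elim: p pU {size_p pth Uxp} => [|y p IHp] /=; first by exists [::].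
  by case/andP=> yU /IHp[q <-]; exists (exist _ y yU :: q).
exists (exist _ x xU : H), q; split; last by rewrite -def_q size_map.
  move: pth; rewrite -def_q -[x]/(val (exist _ x xU : H)) path_map.
  apply: sub_path => u v /= /andP[uv uvF].
  by rewrite /adj /= inE imsetU1 imset_set1 inE uvF andbT.
by rewrite -(map_inj_uniq val_inj) /= def_q.
Qed.

End Cycles.

Theorem theorem4 (G : sgraph) (connG : connected G) (cardE : 2 <= #|edges G|) :
  (exists Ec : {set {set G}},
     [/\ forall A : {set G}, A \in Ec -> connecting_edge A,
         ~ connected (del_edges Ec)
       & ~ contains_path_of_length (edge_induced_subgraph Ec) 4]) ->
  exists delta : edge G -> color, NAC_coloring delta.
Proof.
case=> Ec [conn disconn no_path].
have [a [b not_ab]] : exists a b : G, ~~ connect (@adj (del_edges Ec)) a b.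
  have [/forallP all_conn|/forallPn[a /forallPn[b ab]]] :=
    boolP [forall a : G, forall b : G, connect (@adj (del_edges Ec)) a b].
    by case: disconn => a b; have /forallP := all_conn a; apply.
  by exists a, b.
pose S : {set G} := [set x : G | connect (@adj (del_edges Ec)) a x].
have crossing_Ec (x y : G) :
    adj x y -> [set x; y] \in crossing S -> [set x; y] \in Ec.
  (* An edge outside [Ec] survives the deletion, so [a] reaches both of its ends or neither. *)
  rewrite crossing_set2 => xy; apply: contraR => xyEc.
  have xy' : @adj (del_edges Ec) x y by rewrite /adj /= inE xyEc.
  have yx' : @adj (del_edges Ec) y x by rewrite adjC.
  rewrite !inE; apply/eqP; apply/idP/idP => /connect_trans; apply;
    exact: connect1.
have [/forall_inP all_cross|/forall_inPn[B EB B_cross]] :=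
  boolP [forall (A | A \in edges G), A \in crossing S].
  apply: triangle_free_NAC => // A EA; apply: conn.
  have /eqP/cards2P[x [y [_ def_A]]] := edges_card2 EA.
  by rewrite def_A in EA *; apply: crossing_Ec => //; apply: all_cross.
exists (coloring_of (crossing S)); apply: coloring_of_NAC.
(* A red edge exists: a walk in [G] from [a] to [b] has to leave [S]. *)
- have /connectP[p pth def_b] := connG a b.
  have aS : a \in S by rewrite inE connect0.
  have : last a p \notin S by rewrite -def_b inE.
  elim: p {def_b} (a) aS pth => [|y p IHp] x xS /=; first by rewrite xS.
  case/andP=> xy pth; have [yS|yS _] := boolP (y \in S); first exact: IHp.
  by exists [set x; y]; rewrite ?crossing_set2 ?xS // (negbTE yS).
- by exists B.
(* A blue path stays on one side of [S]. *)
- move=> x p _ pth; rewrite crossing_set2 negbK.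
  elim: p x pth => //= y p IHp x /andP[/andP[_]].
  by rewrite crossing_set2 negbK => /eqP -> /IHp.
move=> x [|u [|v [|w [|z p]]]] Cc //.
- case/andP=> /andP[xu cross_xu] _.
  by case: (triangle_connecting_edge Cc); apply: conn; apply: crossing_Ec.
(* Three crossings put [x] and [w] on opposite sides. *)
- rewrite /= !crossing_set2 => /and4P[/andP[_ xu] /andP[_ uv] /andP[_ vw] _].
  by move: xu uv vw; case: (x \in S) (u \in S) (v \in S) (w \in S) => -[] [] [].
move=> pth; case: no_path.
(* The first four edges of the red path suffice. *)
apply: (@contains_path_of_length_edge_induced _ Ec x [:: u; v; w; z]) => //.
  have: path [rel u v | adj u v && ([set u; v] \in crossing S)] x [:: u; v; w; z].
    by case/and5P: pth => /= -> -> -> ->.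
  by apply: sub_path => s t /= /andP[st cross_st]; rewrite st crossing_Ec.
have := is_cycle_uniq Cc.
by rewrite -[_ :: _]/([:: x; u; v; w; z] ++ p) cat_uniq => /and3P[].
Qed.
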